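(* Let $G$ be a Polish group acting continuously on a Polish space $X$. Let $d$ be a lower semicontinuous pseudometric on $X$ (possibly attaining the value $\infty$) such that $d(x,y)=d(gx,gy)$ for all $x,y\in X$ and $g\in G$. Suppose moreover that there is a family $\Phi$ of continuous pseudometrics on $X$ such that $d=\sup_{\varphi\in\Phi}\varphi$ pointwise on $X\times X$. Let $\varrho_{G,d}$ be the orbit pseudometric on $X$ defined by $$\varrho_{G,d}(x,y)=\inf_{g\in G} d(gx,y).$$ Then $\varrho_{G,d}$ is Borel-uniformly continuous reducible to the Gromov-Hausdorff distance $\varrho_{GH}$ on $F(\mathbb{U})\setminus\{\emptyset\}$.
   Context: Pseudometrics are allowed to take the value $\infty$. For pseudometrics $\varrho_X,\varrho_Y$ on Polish spaces $X,Y$, $\varrho_X$ is Borel-uniformly continuous (Borel-u.c.) reducible to $\varrho_Y$ if there is a Borel map $f:X\to Y$ such that for every $\varepsilon>0$ there are $\delta_X>0,\delta_Y>0$ with $\varrho_X(x,x')<\delta_X\Rightarrow\varrho_Y(f(x),f(x'))<\varepsilon$ and $\varrho_Y(f(x),f(x'))<\delta_Y\Rightarrow\varrho_X(x,x')<\varepsilon$ for all $x,x'\in X$. The Urysohn space $\mathbb{U}$ is the unique (up to isometry) Polish metric space such that for every finite metric space $A$, every $B\subseteq A$ and every isometric embedding $i:B\to\mathbb{U}$ there is an isometric embedding $A\to\mathbb{U}$ extending $i$. $F(\mathbb{U})\setminus\{\emptyset\}$ is the set of nonempty closed subsets of $\mathbb{U}$ with the Wijsman topology, i.e. the coarsest topology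 making $F\mapsto \mathrm{dist}(x,F)$ continuous for every $x\in\mathbb{U}$; it is a Polish space. The Gromov-Hausdorff distance of nonempty metric spaces $M,N$ is $\varrho_{GH}(M,N)=\inf \varrho_H(i_M(M),i_N(N))$, the infimum over all metric spaces $Z$ and isometric embeddings $i_M:M\to Z$, $i_N:N\to Z$, where $\varrho_H$ is the Hausdorff distance; it is regarded as a pseudometric on $F(\mathbb{U})\setminus\{\emptyset\}$ (each element being a metric space with the metric of $\mathbb{U}$). *)

(* Defs.v *)
From HB Require Import structures.
From mathcomp Require Import all_boot all_order all_algebra.
From mathcomp Require Import all_classical all_reals all_analysis.

Set Implicit Arguments.
Unset Strict Implicit.
Unset Printing Implicit Defensive.

Import Order.TTheory GRing.Theory Num.Theory.
Import numFieldNormedType.Exports.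

Local Open Scope classical_set_scope.
Local Open Scope ring_scope.

(* The library's [completeType] is pointed; the empty space is allowed here. *)
Definition complete_space (T : uniformType) : Prop :=
  forall F : set_system T, ProperFilter F -> cauchy F -> exists l : T, F --> l.

Definition separable_space (T : topologicalType) : Prop :=
  exists2 D : set T, countable D & dense D.

Definition completely_metrizable (R : realType) (T : topologicalType) : Prop :=
  exists (M : metricType R) (f : T -> M) (g : M -> T),
    [/\ cancel f g, cancel g f, continuous f, continuous g & complete_space M].

Definition polish_space (R : realType) (T : topologicalType) : Prop :=
  separable_space T /\ completely_metrizable R T.

HB.mixin Record isTopologicalGroup G & Topological G & Group G := {
  mulg_continuous : continuous (fun p : G * G => (p.1 * p.2)%g) ;
  invg_continuous : continuous (fun x : G => (x^-1)%g)
}.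

#[short(type="topologicalGroupType")]
HB.structure Definition TopologicalGroup :=
  {G of Topological G & Group G & isTopologicalGroup G}.

Definition continuous_action (G : topologicalGroupType) (X : topologicalType)
    (act : G -> X -> X) : Prop :=
  [/\ forall x, act 1%g x = x,
      forall g h x, act (g * h)%g x = act g (act h x)
    & continuous (fun p : G * X => act p.1 p.2)].

Definition pseudometric (R : realType) (X : Type) (d : X -> X -> \bar R) : Prop :=
  [/\ forall x y, (0 <= d x y)%E,
      forall x, d x x = 0%E,
      forall x y, d x y = d y x
    & forall x y z, (d x z <= d x y + d y z)%E].

Definition orbit_pseudometric (R : realType) (G X : Type) (act : G -> X -> X)
    (d : X -> X -> \bar R) (x y : X) : \bar R :=
  ereal_inf [set d (act g x) y | g in [set: G]].

(* [<<s open >>] is the Borel sigma-algebra; [measurable_fun] would require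
   pointed types. *)
Definition borel_map (X Y : topologicalType) (f : X -> Y) : Prop :=
  forall B : set Y, <<s open >> B -> <<s open >> (f @^-1` B).

Definition borel_uc_reducible (R : realType) (X Y : topologicalType)
    (rhoX : X -> X -> \bar R) (rhoY : Y -> Y -> \bar R) : Prop :=
  exists2 f : X -> Y, borel_map f &
    forall eps : R, 0 < eps ->
      exists deltaX deltaY : R,
        [/\ 0 < deltaX, 0 < deltaY,
            forall x x', (rhoX x x' < deltaX%:E)%E ->
              (rhoY (f x) (f x') < eps%:E)%E
          & forall x x', (rhoY (f x) (f x') < deltaY%:E)%E ->
              (rhoX x x' < eps%:E)%E].

Section subspace_metric.
Context {R : realType} {X : metricType R} (A : set X).

Let dist (x y : A) : R := mdist (set_val x) (set_val y).

Let dist_ge0 x y : 0 <= dist x y.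
Proof. exact: mdist_ge0. Qed.

Let dist_positivity x y : dist x y = 0 -> x = y.
Proof. by move=> /mdist_positivity/val_inj. Qed.

Let ballEdist (x : A) r : ball x r = [set y | dist x y < r].
Proof. by rewrite -initial_ballE ballEmdist. Qed.

HB.instance Definition _ := @PseudoMetric_isMetric.Build R (set_type A)
  dist dist_ge0 dist_positivity ballEdist.

End subspace_metric.

Definition isometric_embedding (R : realType) (M N : metricType R)
    (f : M -> N) : Prop :=
  forall x y, mdist (f x) (f y) = mdist x y.

Definition urysohn_space (R : realType) (U : metricType R) : Prop :=
  [/\ separable_space U, complete_space U
    & forall (A : metricType R) (B : set A) (i : B -> U),
        finite_set [set: A] -> isometric_embedding i ->
        exists2 j : A -> U, isometric_embedding j
          & forall b : B, j (set_val b) = i b].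

(* Only meaningful for nonempty [A], as [inf set0 = 0]. *)
Definition dist_to_set (R : realType) (M : metricType R) (x : M) (A : set M)
    : R :=
  inf [set mdist x a | a in A].

Definition hausdorff_dist (R : realType) (Z : metricType R) (A B : set Z)
    : \bar R :=
  maxe (ereal_sup [set (dist_to_set a B)%:E | a in A])
       (ereal_sup [set (dist_to_set b A)%:E | b in B]).

Definition gromov_hausdorff_dist (R : realType) (M N : metricType R) : \bar R :=
  ereal_inf [set r | exists (Z : metricType R) (iM : M -> Z) (iN : N -> Z),
    [/\ isometric_embedding iM, isometric_embedding iN
      & r = hausdorff_dist (range iM) (range iN)]].

Definition closed_nonempty (T : topologicalType) : Type :=
  {A : set T | closed A /\ A !=set0}.

HB.instance Definition _ (T : topologicalType) :=
  gen_eqMixin (closed_nonempty T).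
HB.instance Definition _ (T : topologicalType) :=
  gen_choiceMixin (closed_nonempty T).

Definition wijsman_dist (R : realType) (U : metricType R) (x : U)
    (F : closed_nonempty U) : R :=
  dist_to_set x (sval F).

HB.instance Definition _ (R : realType) (U : metricType R) :=
  Topological.copy (closed_nonempty U)
    (sup_topology (fun x : U =>
       Topological.class (initial_topology (wijsman_dist x)))).

Definition gh_closed_nonempty (R : realType) (U : metricType R)
    (E F : closed_nonempty U) : \bar R :=
  gromov_hausdorff_dist (set_type (sval E)) (set_type (sval F)).

(* Main.v *)
Require Import Defs.
From HB Require Import structures.
From mathcomp Require Import all_boot all_order all_algebra.
From mathcomp Require Import all_classical all_reals all_analysis.
From mathcomp Require Import zify lra.

Set Implicit Arguments.
Unset Strict Implicit.
Unset Printing Implicit Defensive.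

Import Order.TTheory GRing.Theory Num.Theory.
Import numFieldNormedType.Exports.

Local Open Scope classical_set_scope.
Local Open Scope ring_scope.

(* A point x is coded by the set of all (g, k, g^-1 x), g in G, k in nat. The
   k-th layer is placed near position 10 k on a half-line, the exact position
   being shifted by h_m(g^-1 x), where h_m is the m-th of countably many
   continuous functions X -> [0, 1] such that sup_m |h_m(x) - h_m(y)| is at most
   d(x, y) and is small only if d(x, y) is, and each m occurs on infinitely many
   layers. To this one adds the distance min(1, 2^k D(g, g')) for a compatible
   left-invariant metric D on G. All these codes lie in one separable space,
   embedded in U, and left translation identifies the codes of x and g x; so
   d(g x, y) <= c makes the codes c-close.

   Conversely a correspondence of small distortion respects positions, hence
   layers and labels, and moves G on layer k with error 2^-k in D. As D need not
   be complete, a back-and-forth argument with a complete metric on G produces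
   related sequences g_n -> g and t_n -> t in G along which every label is seen
   infinitely often; so d(g^-1 x, t^-1 y) is small. *)

(** * Isometric embeddings into the Urysohn space *)

Section metric_neighbourhoods.
Context {R : realType} {M : metricType R}.

Lemma nbhs_mdistP (x : M) (A : set M) :
  nbhs x A <-> exists2 e : R, 0 < e & forall y, mdist x y < e -> A y.
Proof.
split => [/nbhs_ballP[e e0 eA]|[e e0 eA]].
  by exists e => // y xy; apply: eA; rewrite ballEmdist.
by apply/nbhs_ballP; exists e => //= y; rewrite ballEmdist => /eA.
Qed.

Lemma nbhs_mdist_lt (x : M) (e : R) : 0 < e -> nbhs x [set y | mdist x y < e].
Proof. by move=> e0; apply/nbhs_mdistP; exists e. Qed.

Lemma closure_mdistP (A : set M) (x : M) :
  closure A x <-> forall e : R, 0 < e -> exists2 a, A a & mdist x a < e.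
Proof.
split => [Ax e e0|Ax B /nbhs_mdistP[e /Ax[a Aa xa] eB]].
  by have [y [Ay xy]] := Ax _ (nbhs_mdist_lt x e0); exists y.
by exists a; split => //; exact: eB.
Qed.

Lemma complete_mdist (F : set_system M) : complete_space M -> ProperFilter F ->
  (forall e : R, 0 < e -> exists x, F [set y | mdist x y < e]) ->
  exists l, forall e : R, 0 < e -> F [set y | mdist l y < e].
Proof.
move=> Mc FF Fc; have [|l Fl] := Mc F FF.
  by apply/cauchy_exP => e /Fc[x Fx]; exists x; rewrite ballEmdist.
by exists l => e e0; apply: Fl; exact: nbhs_mdist_lt.
Qed.

End metric_neighbourhoods.

Definition real_pseudometric (R : realType) (Z : Type) (rho : Z -> Z -> R) :=
  [/\ forall x, rho x x = 0, forall x y, rho x y = rho y x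
    & forall x y z, rho x z <= rho x y + rho y z].

Lemma real_pseudometric_ge0 (R : realType) (Z : Type) (rho : Z -> Z -> R) x y :
  real_pseudometric rho -> 0 <= rho x y.
Proof.
move=> [r0 rC rD]; have := rD x y x; rewrite r0 (rC y x).
by rewrite -mulr2n pmulrn_lge0.
Qed.

Lemma mdist_real_pseudometric (R : realType) (M : metricType R) :
  real_pseudometric (@mdist R M).
Proof. by split; [exact: mdistxx|exact: metric_sym|exact: metric_triangle]. Qed.

Lemma eq_approx (R : realType) (a b : R) :
  (forall e, 0 < e -> `|a - b| <= e) -> a = b.
Proof.
move=> ab; apply/eqP; rewrite -subr_eq0 -normr_le0.
by apply/ler_addgt0Pl => e e0; rewrite addr0 ab.
Qed.

(** The values [u i] at those [z i] that are close to [p] form a Cauchy filter base in [U], and its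
    limit serves as [iota p]. The index type is arbitrary, so that the lemma covers both sequences
    and families over [G * nat]. *)
Lemma isometry_extension (R : realType) (Z I : Type) (rho : Z -> Z -> R)
    (U : metricType R) (z : I -> Z) (u : I -> U) :
  complete_space U -> real_pseudometric rho ->
  (forall p e, 0 < e -> exists i, rho p (z i) < e) ->
  (forall i j, mdist (u i) (u j) = rho (z i) (z j)) ->
  exists2 iota : Z -> U, forall p q, mdist (iota p) (iota q) = rho p q
    & forall p i, mdist (iota p) (u i) = rho p (z i).
Proof.
move=> Uc [r0 rC rD] zd uz.
have key p : exists l, forall e, 0 < e ->
    exists i, rho p (z i) < e /\ mdist l (u i) < e.
  pose F : set_system U :=
    filter_from [set e : R | 0 < e] (fun e => u @` [set i | rho p (z i) < e]).
  have FF : ProperFilter F.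
    apply: filter_from_proper; last first.
      by move=> e /(zd p)[i pi]; exists (u i); exists i.
    apply: filter_from_filter; first by exists 1 => /=.
    move=> e e' /= e0 e'0; exists (Num.min e e') => /=.
      by rewrite lt_min e0.
    move=> _ [i pi <-]; move: pi => /=; rewrite lt_min => /andP[? ?].
    by split; exists i.
  have [e e0|l Fl] := complete_mdist Uc FF.
    have e20 : 0 < e / 2 by rewrite divr_gt0.
    have [i pi] := zd p _ e20; exists (u i), (e / 2) => // _ [j /= pj <-].
    by rewrite uz; have := rD (z i) p (z j); rewrite (rC (z i) p); lra.
  exists l => e e0; have : F (u @` [set i | rho p (z i) < e]) by exists e.
  move=> /(filterI (Fl e e0))/filter_ex[y [/= ly [i pi uiy]]].
  by exists i; rewrite uiy.
have /choice[iota iotaP] := key.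
have iu p i : mdist (iota p) (u i) = rho p (z i).
  apply: eq_approx => e e0; have e20 : 0 < e / 2 by rewrite divr_gt0.
  have [j [pj lj]] := iotaP p _ e20.
  have := metric_triangle (iota p) (u j) (u i).
  have := metric_triangle (u j) (iota p) (u i); rewrite uz (metric_sym (u j)).
  have := rD p (z j) (z i); have := rD (z j) p (z i); rewrite (rC (z j) p).
  by rewrite ler_norml; lra.
exists iota => // p q.
apply: eq_approx => e e0; have e20 : 0 < e / 2 by rewrite divr_gt0.
have [j [pj lj]] := iotaP q _ e20.
have := metric_triangle (iota p) (u j) (iota q); rewrite (metric_sym (u j)).
have := metric_triangle (iota p) (iota q) (u j); rewrite iu.
have := rD p (z j) q; have := rD p q (z j); rewrite (rC (z j) q).
by rewrite ler_norml; lra.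
Qed.

Section metrized.
Context {R : realType} {T : choiceType} (delta : T -> T -> R).
Hypothesis delta_pseudometric : real_pseudometric delta.
Hypothesis delta_eq0 : forall x y, delta x y = 0 -> x = y.

(* The two proof arguments only let the metric instance be inferred. *)
Definition metrized of real_pseudometric delta
  & (forall x y, delta x y = 0 -> x = y) : Type := T.

Local Notation MT := (metrized delta_pseudometric delta_eq0).

Let delta_xx x : delta x x = 0.
Proof. by case: delta_pseudometric. Qed.

Let delta_sym x y : delta x y = delta y x.
Proof. by case: delta_pseudometric. Qed.

Let delta_triangle y x z : delta x z <= delta x y + delta y z.
Proof. by case: delta_pseudometric. Qed.

HB.instance Definition _ := Choice.copy MT T.
HB.instance Definition _ := isMetric.Build R MT
  delta_xx delta_eq0 delta_sym delta_triangle.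

End metrized.

(** The inequalities make [r] a Katetov function on [s], that is, a possible distance function from
    one new point. The extension property is applied to [s] with that point, [None], adjoined. *)
Lemma urysohn_one_point (R : realType) (U : metricType R) (s : seq U)
    (r : U -> R) : urysohn_space U ->
  {in s &, forall a b, `|r a - r b| <= mdist a b <= r a + r b} ->
  exists v, {in s, forall a, mdist v a = r a}.
Proof.
move=> [_ _ Uext] rs.
have r_ge0 a : a \in s -> 0 <= r a.
  by move=> sa; have := rs a a sa sa; rewrite mdistxx => /andP[_]; lra.
(* A zero of [r] is itself the required point. Without zeros, [delta] below separates [None] from
   [s] and is a metric, not only a pseudometric. *)
have [[a sa ra]|rn0] := pselect (exists2 a, a \in s & r a = 0).
  exists a => b sb; have := rs a b sa sb; rewrite ra sub0r normrN add0r.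
  by rewrite ger0_norm ?r_ge0// -eq_le => /eqP.
pose T : choiceType := option (seq_sub s).
pose delta (x y : T) : R := match x, y with
  | Some a, Some b => mdist (val a) (val b)
  | Some a, None | None, Some a => r (val a)
  | None, None => 0 end.
have delta_pm : real_pseudometric delta.
  split; first by case=> [a|] /=; rewrite ?mdistxx.
    by move=> [a|] [b|] //=; rewrite metric_sym.
  move=> [a|] [b|] [c|] /=; rewrite ?addr0 ?add0r//.
  - exact: metric_triangle.
  - have /andP[+ _] := rs _ _ (valP a) (valP b).
    by rewrite ler_norml; lra.
  - by have /andP[_] := rs _ _ (valP a) (valP c).
  - have /andP[+ _] := rs _ _ (valP b) (valP c).
    by rewrite ler_norml; lra.
  - by rewrite addr_ge0// r_ge0// (valP b).
have delta_eq0 x y : delta x y = 0 -> x = y.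
  move: x y => [a|] [b|] //= ab; last 2 first.
  - by case: rn0; exists (val a) => //; exact: (valP a).
  - by case: rn0; exists (val b) => //; exact: (valP b).
  by congr Some; apply: val_inj; exact: mdist_positivity.
pose A : metricType R := metrized delta_pm delta_eq0.
pose B : set A := [set (Some a : A) | a in setT].
have BP (b : B) : exists a, (Some a : A) = set_val b.
  by have [a _ ab] := set_valP b; exists a.
have [i iP] := choice BP.
have [|b b'|j jisom ji] := Uext A B (val \o i).
- exact: (@finite_finset T setT).
- by rewrite /mdist/= -!iP.
exists (j None) => a sa.
pose a' : seq_sub s := SeqSub sa.
have Ba : B (Some a') by exists a'.
have jia : j (Some a') = a.
  pose b : B := SigSub (mem_set Ba).
  have bE : set_val b = Some a' by [].
  have := ji b; rewrite bE => ->/=.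
  by have := iP b; rewrite bE => -[->].
by rewrite -{1}jia jisom.
Qed.

(** Recursion on one-point extensions: the point added to the list [s] has the distances of
    [z (size s)] to the earlier [z i]. *)
Lemma urysohn_sequence (R : realType) (U : metricType R) (Z : Type)
    (rho : Z -> Z -> R) (z : nat -> Z) : urysohn_space U ->
  real_pseudometric rho ->
  exists u : nat -> U, forall i j, mdist (u i) (u j) = rho (z i) (z j).
Proof.
move=> Uu rho_pm; have [r0 rC rD] := rho_pm.
have [u0 _] : exists u0 : U, {in [::], forall a, mdist u0 a = 0}.
  exact: (urysohn_one_point (r := fun=> 0) Uu).
pose good (s : seq U) := forall i j, (i < size s)%N -> (j < size s)%N ->
  mdist (nth u0 s i) (nth u0 s j) = rho (z i) (z j).
(* [good s] is a premise under the quantifier so that choice yields a total function [V]; bad lists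
   get the junk value [u0]. *)
have step s : exists v, good s ->
    forall i, (i < size s)%N -> mdist v (nth u0 s i) = rho (z (size s)) (z i).
  have [gs|] := pselect (good s); last by exists u0.
  pose r a := rho (z (size s)) (z (index a s)).
  have [|v vP] := urysohn_one_point (s := s) (r := r) Uu.
    move=> a b sa sb; rewrite /r.
    have := gs (index a s) (index b s); rewrite !index_mem !nth_index//.
    move=> /(_ sa sb) ->; set p := z (size s); set x := z _; set y := z _.
    have := rD p x y; have := rD p y x; have := rD x p y.
    by rewrite ler_norml (rC y x) (rC x p); lra.
  exists v => _ i si; rewrite vP ?mem_nth// /r.
  (* Since [rho] may vanish off the diagonal, [s] may have repetitions and [j] may differ from [i].
     Then [z i] and [z j] are at distance 0, so either gives the same value. *)
  set j := index _ s; have sj : (j < size s)%N by rewrite index_mem mem_nth.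
  have : rho (z i) (z j) = 0 by rewrite -gs// /j nth_index ?mem_nth// mdistxx.
  have := rD (z (size s)) (z i) (z j); have := rD (z (size s)) (z j) (z i).
  by rewrite (rC (z j)); lra.
have [V VP] := choice step.
pose s := fix s n := if n is n'.+1 then rcons (s n') (V (s n')) else [::].
have size_s n : size (s n) = n by elim: n => //= n IH; rewrite size_rcons IH.
have good_s n : good (s n).
  elim: n => [|n IH]; first by move=> i j.
  have lastP i : (i < n)%N -> mdist (V (s n)) (nth u0 (s n) i) = rho (z n) (z i).
    by move=> ni; rewrite VP ?size_s.
  move=> i j; rewrite /= size_rcons size_s !ltnS !nth_rcons size_s.
  case: (ltngtP i n) => // [ni|->] _; case: (ltngtP j n) => // [nj|->] _.
  - by rewrite IH ?size_s.
  - by rewrite metric_sym lastP// rC.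
  - exact: lastP.
  - by rewrite mdistxx r0.
have s_nth i n : (i < n)%N -> nth u0 (s n) i = nth u0 (s i.+1) i.
  elim: n => // n IH; rewrite ltnS leq_eqVlt => /orP[/eqP -> //|ni].
  by rewrite /= nth_rcons size_s ni IH.
exists (fun i => nth u0 (s i.+1) i) => i j.
rewrite -(@s_nth i (maxn i j).+1) ?ltnS ?leq_maxl//.
rewrite -(@s_nth j (maxn i j).+1) ?ltnS ?leq_maxr//.
by apply: good_s; rewrite size_s ltnS ?leq_maxl ?leq_maxr.
Qed.

Lemma urysohn_embedding (R : realType) (U : metricType R) (Z : Type)
    (rho : Z -> Z -> R) (z : nat -> Z) : urysohn_space U ->
  real_pseudometric rho -> (forall p e, 0 < e -> exists i, rho p (z i) < e) ->
  exists iota : Z -> U, forall p q, mdist (iota p) (iota q) = rho p q.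
Proof.
move=> Uu rho_pm zd; have [u uz] := urysohn_sequence z Uu rho_pm.
have [_ Uc _] := Uu.
by have [iota iotaP _] := isometry_extension Uc rho_pm zd uz; exists iota.
Qed.

Lemma half_expr_lt (R : realType) (e : R) : 0 < e -> exists n, 2^-1 ^+ n < e.
Proof.
move=> e0; have [n _ /(_ n (leqnn n))] := near_infty_natSinv_expn_lt (PosNum e0).
by rewrite /= div1r -exprVn; exists n.
Qed.

(** * Invariant metrics on Polish groups *)

(** The metric is pulled back along the homeomorphism, so that later arguments stay on [T], with
    completeness phrased for sequences. *)
Lemma completely_metrizable_pseudometric (R : realType) (T : topologicalType) :
  completely_metrizable R T -> exists rho : T -> T -> R,
  [/\ real_pseudometric rho,
      forall x (V : set T), nbhs x V <->
        exists2 e, 0 < e & forall y, rho x y < e -> V y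
    & forall u : nat -> T,
        (forall e, 0 < e ->
           exists N, forall n, (N <= n)%N -> rho (u N) (u n) < e) ->
        exists l : T, forall V, nbhs l V ->
          exists N, forall n, (N <= n)%N -> V (u n)].
Proof.
move=> [M [f [g [fK gK cf cg Mc]]]]; exists (fun x y => mdist (f x) (f y)).
split.
- split=> [x|x y|x y z]; first exact: mdistxx.
    exact: metric_sym.
  exact: metric_triangle.
- move=> x V; split => [xV|[e e0 eV]].
    have : nbhs (f x) (g @^-1` V) by apply: cg; rewrite fK.
    by move=> /nbhs_mdistP[e e0 eV]; exists e => // y /eV/=; rewrite fK.
  have : nbhs x (f @^-1` [set y | mdist (f x) y < e]).
    by apply: cf; exact: nbhs_mdist_lt.
  by apply: filterS => y /= /eV.
- move=> u uc; have [e /uc[N Nu]|l Fl] := complete_mdist (F := (f \o u) @ \oo) Mc _.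
    by exists (f (u N)); exists N => // n /=; exact: Nu.
  exists (g l) => V /cg/nbhs_mdistP[e /Fl[N _ Nl] eV].
  by exists N => n /Nl/eV; rewrite /= fK.
Qed.

Definition compatible_left_invariant (R : realType) (G : topologicalGroupType)
    (D : G -> G -> R) :=
  [/\ real_pseudometric D, forall a g h, D (a * g)%g (a * h)%g = D g h,
      forall g e, 0 < e -> nbhs g [set h | D g h < e]
    & forall g V, nbhs g V -> exists2 e, 0 < e & forall h, D g h < e -> V h].

Section birkhoff_kakutani.
Context {R : realType} {G : topologicalGroupType}.
Local Notation half := (2^-1 : R).

Lemma nbhs_cube (W : set G) : nbhs 1%g W -> exists2 V, nbhs 1%g V &
  forall a b c, V a -> V b -> V c -> W (a * b * c)%g.
Proof.
move=> W1.
have mulnbhs (A : set G) : nbhs 1%g A -> exists2 B, nbhs 1%g B &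
    forall a b, B a -> B b -> A (a * b)%g.
  move=> A1; have /= := @mulg_continuous G (1, 1)%g.
  rewrite /continuous_at/= mulg1 => /(_ A A1)/= [[B C]/= [B1 C1] BC].
  exists (B `&` C); first exact: filterI.
  by move=> a b [Ba _] [_ Cb]; exact: (BC (a, b)).
have [B B1 BW] := mulnbhs _ W1; have [C C1 CB] := mulnbhs _ B1.
exists (B `&` C); first exact: filterI.
by move=> a b c [_ Ca] [_ Cb] [Bc _]; apply: BW => //; exact: CB.
Qed.

Lemma nbhs_mulgl (g : G) (V : set G) :
  nbhs g V -> nbhs 1%g [set a | V (g * a)%g].
Proof.
move=> gV; have /= := @mulg_continuous G (g, 1)%g.
rewrite /continuous_at/= mulg1 => /(_ V gV)/= [[B C]/= [B1 C1] BC].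
apply: filterS C1 => a Ca; apply: (BC (g, a)); split => //=.
exact: nbhs_singleton.
Qed.

Lemma nbhs_divgl (g : G) (V : set G) :
  nbhs 1%g V -> nbhs g [set h | V (g^-1 * h)%g].
Proof.
move=> gV; have /= := @mulg_continuous G (g^-1, g)%g.
rewrite /continuous_at/= mulVg => /(_ V gV)/= [[B C]/= [B1 C1] BC].
apply: filterS C1 => a Ca; apply: (BC (g^-1%g, a)); split => //=.
exact: nbhs_singleton.
Qed.

Lemma nbhs_divgr (g : G) (V : set G) :
  nbhs 1%g V -> nbhs g [set h | V (h^-1 * g)%g].
Proof.
move=> gV; have /= := @mulg_continuous G (g^-1, g)%g.
rewrite /continuous_at/= mulVg => /(_ V gV)/= [[B C]/= [B1 C1] BC].
have Bg : nbhs g [set h | B (h^-1)%g] := @invg_continuous G g B B1.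
apply: filterS Bg => a Ba; apply: (BC (a^-1%g, g)); split => //=.
exact: nbhs_singleton.
Qed.

(* [chain V l w g]: [g] is a product of [l] elements taken from sets
   [V n_1, ..., V n_l] of total weight [w], [V n] having weight [1 / 2 ^ n]. *)
Inductive chain (V : nat -> set G) : nat -> R -> G -> Prop :=
| chain_nil : chain V 0 0 1%g
| chain_cons n a l w g : V n a -> chain V l w g ->
    chain V l.+1 (half ^+ n + w) (a * g)%g.

Lemma chain_ge0 V l w g : chain V l w g -> 0 <= w.
Proof. by elim => // n a {}l {}w {}g _ _ w0; rewrite addr_ge0// exprn_ge0. Qed.

Lemma chain_cat V l w g l' w' g' : chain V l w g -> chain V l' w' g' ->
  chain V (l + l') (w + w') (g * g')%g.
Proof.
move=> c c'; elim: c => [|n a {}l {}w {}g Va _ IH]; first by rewrite add0r mul1g.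
by rewrite addSn -addrA -mulgA; exact: chain_cons.
Qed.

(** The cut is made at the first factor with which the partial weight exceeds [c]; what follows it
    weighs less than [w - c]. *)
Lemma chain_split V l w g (c : R) : 0 <= c -> chain V l w g -> c < w ->
  exists l1 w1 g1 n a l2 w2 g2,
  [/\ chain V l1 w1 g1, chain V l2 w2 g2, V n a,
      g = (g1 * a * g2)%g & l = (l1 + l2).+1] /\
  [/\ w = w1 + half ^+ n + w2, w1 <= c & c < w1 + half ^+ n].
Proof.
move=> c0 ch; elim: ch c c0 => [|n a {}l {}w {}g Va ch IH] c c0 cw.
  by move: cw; rewrite ltNge c0.
have [cn|nc] := ltP c (half ^+ n).
  exists 0%N, 0, 1%g, n, a, l, w, g; rewrite mul1g !add0r.
  by split => //; split => //; exact: chain_nil.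
have [||l1 [w1 [g1 [m [b [l2 [w2 [g2 [[ch1 ch2 Vb -> ->] [-> w1c cw1]]]]]]]]]] :=
    IH (c - half ^+ n); [lra|lra|].
exists l1.+1, (half ^+ n + w1), (a * g1)%g, m, b, l2, w2, g2.
split; first by split; rewrite ?mulgA//; exact: chain_cons.
by split; lra.
Qed.

(** Strong induction on the length. Cutting at half the weight leaves two outer pieces lighter than
    [half ^+ n.+1] and a middle factor from some [V m] with [n < m]; all three lie in [V n.+1], so
    their product lies in [V n]. *)
Lemma chain_mem V l w g n : V 0 = setT -> (forall n, V n 1%g) ->
  (forall n a b c, V n.+1 a -> V n.+1 b -> V n.+1 c -> V n (a * b * c)%g) ->
  chain V l w g -> w < half ^+ n -> V n g.
Proof.
move=> V0 V1 V3.
have Vle i j : (i <= j)%N -> V j `<=` V i.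
  move=> /subnK <-; elim: (j - i)%N => // k IH a Va; apply: IH.
  by rewrite -(mulg1 a) -(mulg1 (a * 1)%g); exact: V3.
have [k] := ubnP l; elim: k => // k IH in l w g n * => lk ch wn.
have [w0|w0] := ltP 0 w; last first.
  case: ch lk w0 {wn} => // m a {}l {}w {}g _ /chain_ge0 w0 _.
  have : 0 < half ^+ m by rewrite exprn_gt0.
  lra.
have [||l1 [w1 [g1 [m [a [l2 [w2 [g2 [[ch1 ch2 Va -> ll] [ww w1c cw1]]]]]]]]]] :=
    chain_split (c := w / 2) _ ch; [lra|lra|].
have E : half ^+ n.+1 = half ^+ n / 2 by rewrite exprS mulrC.
have w10 := chain_ge0 ch1; have w20 := chain_ge0 ch2.
apply: V3.
- by apply: IH ch1 _; [lia|lra].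
- apply: Vle Va; rewrite ltnNge; apply/negP => mn.
  have : half ^+ n <= half ^+ m by rewrite ler_wiXn2l//; lra.
  by lra.
- by apply: IH ch2 _; [lia|lra].
Qed.

(** The Birkhoff-Kakutani construction: [f g] is the least total weight of a chain with product [g].
    It is subadditive by concatenation and is comparable with the sets [V n] by [fV] and [Vf]. *)
Lemma birkhoff_kakutani : completely_metrizable R G ->
  exists D : G -> G -> R, compatible_left_invariant D.
Proof.
move=> /completely_metrizable_pseudometric[rho [_ rhoP _]].
have /choice[cube cubeP] (W : set G) : exists V, nbhs 1%g W ->
    nbhs 1%g V /\ forall a b c, V a -> V b -> V c -> W (a * b * c)%g.
  have [/nbhs_cube[V V1 VW]|//] := pselect (nbhs 1%g W); first by exists V.
  by exists set0.
pose B n := [set g : G | rho 1%g g < half ^+ n].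
have B1 n : nbhs 1%g (B n).
  by apply/rhoP; exists (half ^+ n) => //; rewrite exprn_gt0.
pose V := fix V n := if n is n'.+1 then cube (V n') `&` B n' else setT.
have nV n : nbhs 1%g (V n).
  elim: n => [|n IH] /=; first exact: filterT.
  by apply: filterI => //; have [] := cubeP _ IH.
have V1 n : V n 1%g by exact: nbhs_singleton.
have V3 n a b c : V n.+1 a -> V n.+1 b -> V n.+1 c -> V n (a * b * c)%g.
  by move=> [Va _] [Vb _] [Vc _]; have [_] := cubeP _ (nV n); apply.
pose S g := [set w | exists l, chain V l w g].
pose f g := inf (S g).
have S0 g : lbound (S g) 0 by move=> w [l /chain_ge0].
have fS l w g : chain V l w g -> f g <= w.
  by move=> ch; apply: ge_inf; [exists 0; exact: S0|exists l].
(* As [V 0] is the whole group, every [g] is a chain of length one, so the infimum is over a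
   nonempty set. *)
have Sn0 g : S g !=set0.
  exists (half ^+ 0 + 0), 1%N; rewrite -(mulg1 g).
  by apply: chain_cons => //; exact: chain_nil.
have Sf g e : f g < e -> exists l w, chain V l w g /\ w < e.
  by move=> /(inf_lt (Sn0 g))[w [l ch] we]; exists l, w.
have f_ge0 g : 0 <= f g by apply: lb_le_inf.
have f1 : f 1%g = 0.
  by apply/eqP; rewrite eq_le f_ge0 andbT; apply: fS; exact: chain_nil.
have fM g h : f (g * h)%g <= f g + f h.
  apply/ler_addgt0Pr => e e0; have e20 : 0 < e / 2 by rewrite divr_gt0.
  have [|l [w [ch we]]] := Sf g (f g + e / 2); first by rewrite ltrDl.
  have [|l' [w' [ch' we']]] := Sf h (f h + e / 2); first by rewrite ltrDl.
  by have := fS _ _ _ (chain_cat ch ch'); lra.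
have fV n g : V n g -> f g <= half ^+ n.
  move=> Vg; rewrite -[leRHS]addr0 -(mulg1 g).
  by apply/fS/chain_cons => //; exact: chain_nil.
have Vf n g : f g < half ^+ n -> V n g.
  by move=> /Sf[l [w [ch]]]; exact: chain_mem ch.
(* The sets [V n] need not be symmetric, hence the sum of two terms; left invariance holds because
   only [g^-1 * h] and its inverse occur. *)
exists (fun g h => f (g^-1 * h)%g + f (h^-1 * g)%g); split.
- split=> [g|g h|g h k]; first by rewrite mulVg f1 addr0.
    by rewrite addrC.
  have := fM (g^-1 * h)%g (h^-1 * k)%g; have := fM (k^-1 * h)%g (h^-1 * g)%g.
  by rewrite !mulgA !mulgK; lra.
- by move=> a g h; rewrite !invgM -!mulgA !mulKg.
- move=> g e e0; have [|n ne] := @half_expr_lt R (e / 2); first by rewrite divr_gt0.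
  apply: filterS (filterI (nbhs_divgl g (nV n)) (nbhs_divgr g (nV n))).
  by move=> h /= [/fV ? /fV ?]; lra.
- move=> g A /nbhs_mulgl/rhoP[e /half_expr_lt[n ne] eA].
  (* The exponent is shifted because it is [V n.+1] that is contained in [B n]. *)
  exists (half ^+ n.+1); first by rewrite exprn_gt0.
  move=> h ngh; have [|_] := Vf n.+1 (g^-1 * h)%g.
    by have := f_ge0 (h^-1 * g)%g; lra.
  by move=> /lt_trans/(_ ne)/eA/=; rewrite mulVKg.
Qed.

End birkhoff_kakutani.

(** * Back-and-forth construction of convergent sequences in the group *)

(** The [D]-balls are nested and the one about [u n.+1] is within [2^-1 ^+ n] of its centre for
    [rho]. So the centres are Cauchy for [rho], whatever [D] is. *)
Lemma nested_balls_cvg (R : realType) (T : topologicalType) (rho D : T -> T -> R)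
    (u : nat -> T) (r : nat -> R) :
  (forall v : nat -> T,
     (forall e, 0 < e -> exists N, forall n, (N <= n)%N -> rho (v N) (v n) < e) ->
     exists l : T, forall V, nbhs l V -> exists N, forall n, (N <= n)%N -> V (v n)) ->
  (forall x, D x x = 0) -> (forall n, 0 < r n) ->
  (forall n x, D (u n.+1) x < r n.+1 ->
     D (u n) x < r n /\ rho (u n.+1) x < 2^-1 ^+ n) ->
  exists l : T, forall V, nbhs l V -> exists N, forall n, (N <= n)%N -> V (u n).
Proof.
move=> rho_complete D0 r0 ur; apply: rho_complete => e e0.
have nest n m x : (n <= m)%N -> D (u m) x < r m -> D (u n) x < r n.
  move=> /subnK <-; elim: (m - n)%N => // k IH.
  by rewrite addSn => /ur[/IH].
have [n ne] := half_expr_lt e0; exists n.+1 => m nm.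
by have [|_ /lt_trans->] := ur n (u m) => //; apply: nest nm _; rewrite D0.
Qed.

(** [logn 2] serves as a schedule that returns to each label infinitely often; an odd multiple of
    [2 ^ m] is a witness. *)
Lemma logn2_cofinal (m N : nat) : exists2 k, (N <= k)%N & logn 2 k = m.
Proof.
exists (2 ^ m * (2 * N).+1)%N; first by have := expn_gt0 2 m; nia.
rewrite lognM ?expn_gt0// pfactorK// -[RHS]addn0; congr addn.
by apply/eqP; rewrite lognE; case: ifP => // /and3P[_ _]; lia.
Qed.

(* The group need not be complete for [D], so a back-and-forth sequence of
   related pairs is also made to converge for a complete metric. *)
Lemma back_and_forth (R : realType) (G : topologicalGroupType)
    (D : G -> G -> R) (K : nat -> nat -> Prop) (Rel : nat -> G -> G -> Prop) :
  completely_metrizable R G -> compatible_left_invariant D ->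
  (forall m N, exists2 k, (N <= k)%N & K m k) ->
  (forall k g, exists t, Rel k g t) -> (forall k t, exists g, Rel k g t) ->
  (forall k k' g t t', (k <= k')%N -> Rel k g t -> Rel k' g t' ->
     D t t' < 2^-1 ^+ k) ->
  (forall k k' g g' t, (k <= k')%N -> Rel k g t -> Rel k' g' t ->
     D g g' < 2^-1 ^+ k) ->
  exists g t : G, forall m V W, nbhs g V -> nbhs t W ->
    exists k g' t', [/\ K m k, V g', W t' & Rel k g' t'].
Proof.
move=> /completely_metrizable_pseudometric[rho [[rho0 _ _] rhoP rhoc]].
move=> [[D0 DC DD] _ D_nbhs D_base] Kinf Rtot Rsurj Rt Rg.
have fit n g h a : D g h < a -> exists2 b, 0 < b & forall x, D h x < b ->
    D g x < a /\ rho h x < 2^-1 ^+ n.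
  move=> gha.
  have [e e0 eP] : exists2 e, 0 < e & forall x, D h x < e -> rho h x < 2^-1 ^+ n.
    by apply: D_base; apply/rhoP; exists (2^-1 ^+ n) => //; rewrite exprn_gt0.
  exists (Num.min e (a - D g h)); first by rewrite lt_min e0 subr_gt0.
  move=> x; rewrite lt_min => /andP[/eP ? hx]; split => //.
  by have := DD g h x; lra.
have large (a : R) N : 0 < a -> exists2 k, (N <= k)%N & forall k', (k <= k')%N ->
    2^-1 ^+ k' < a.
  move=> a0; have [k _ ka] := near_infty_natSinv_expn_lt (PosNum a0).
  exists (maxn N k); first exact: leq_maxl.
  move=> k'; rewrite geq_max => /andP[_ kk'].
  by have := ka _ kk'; rewrite /= div1r exprVn.
(* A state holds [g] and [t], each with the radius of a [D]-ball that confines its successors, and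
   the level [k] of their relation. The bound [2^-1 ^+ k < a] keeps any later partner of [t] inside
   the ball of [g]. *)
pose S : Type := (G * R * (G * R) * nat)%type.
pose good (s : S) := let: (g, a, (t, b), k) := s in
  [/\ Rel k g t, 2^-1 ^+ k < a & 0 < b].
pose fits n (p q : G * R) := forall x, D q.1 x < q.2 ->
  D p.1 x < p.2 /\ rho q.1 x < 2^-1 ^+ n.
have step (ns : nat * S) : exists s', good ns.2 -> [/\ good s',
    fits ns.1 ns.2.1.1 s'.1.1, fits ns.1 ns.2.1.2 s'.1.2
    & K (logn 2 ns.1) s'.2].
  case: ns => n [[[g a] [t b]] k]; rewrite /good/=.
  have [[gt ka b0]|] := pselect [/\ Rel k g t, 2^-1 ^+ k < a & 0 < b]; last first.
    by exists (g, a, (t, b), k).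
  (* First [g] is replaced by a partner [g'] of [t] on a level [k1] so high that every later partner
     of [g'] stays within [b] of [t]; then [t] is replaced by a partner of [g'] on a level with the
     scheduled property and high enough for the new radius [a']. *)
  have [k1 kk1 k1b] := large b k b0.
  have [g' g't] := Rsurj k1 t.
  have [|a' a'0 a'P] := fit n g g' a; first exact: lt_trans (Rg _ _ _ _ _ kk1 gt g't) ka.
  have [k2 k12 k2a'] := large a' k1 a'0.
  have [k3 k23 Kk3] := Kinf (logn 2 n) k2.
  have [t' g't'] := Rtot k3 g'.
  have [|b' b'0 b'P] := fit n t t' b.
    by apply: lt_trans (k1b _ (leqnn _)); exact: Rt (leq_trans k12 k23) g't g't'.
  exists (g', a', (t', b'), k3) => _; split => //; split => //.
  exact: k2a'.
have [next nextP] := choice step.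
have [t0 gt0] := Rtot 0%N 1%g.
pose s := fix s n : S := if n is n'.+1 then next (n', s n')
  else ((1%g, 2), (t0, 1), 0%N).
have good_s n : good (s n).
  elim: n => [|n IH]; last by have [] := nextP (n, s n) IH.
  by split => //; rewrite expr0; lra.
have sP n := nextP (n, s n) (good_s n).
have [|n|g gP] := nested_balls_cvg (D := D) (u := fun n => (s n).1.1.1)
    (r := fun n => (s n).1.1.2) rhoc D0.
- move=> n; have := good_s n; case: (s n) => [[[? a] [? ?]] k] [_ + _].
  by apply: le_lt_trans; rewrite exprn_ge0.
- by move=> x; have [_ /(_ x)] := sP n.
have [|n|t tP] := nested_balls_cvg (D := D) (u := fun n => (s n).1.2.1)
    (r := fun n => (s n).1.2.2) rhoc D0.
- by move=> n; have := good_s n; case: (s n) => [[[? ?] [? b]] k] [].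
- by move=> x; have [_ _ /(_ x)] := sP n.
exists g, t => m V W /gP[N1 N1V] /tP[N2 N2W].
(* Stage [n] serves the requirement [logn 2 n = m] and produces state [n.+1]. *)
have [n Nn nm] := logn2_cofinal m (N1 + N2).
exists (s n.+1).2, (s n.+1).1.1.1, (s n.+1).1.2.1; split.
- by have [_ _ _ /=] := sP n; rewrite nm.
- by apply: N1V; lia.
- by apply: N2W; lia.
- by have := good_s n.+1; case: (s n.+1) => [[[? ?] [? ?]] ?] [].
Qed.

(** * Countably many labels determining the pseudometric *)

Lemma dense_nbhs (T : topologicalType) (D : set T) (x : T) (V : set T) :
  dense D -> nbhs x V -> exists2 y, D y & V y.
Proof.
move=> Dd; rewrite nbhsE => -[W [Wo Wx] WV].
have [|y [Wy Dy]] := Dd W _ Wo; first by exists x.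
by exists y => //; exact: WV.
Qed.

Lemma dense_sequence (T : topologicalType) : separable_space T -> T ->
  exists u : nat -> T, forall (x : T) V, nbhs x V -> exists i, V (u i).
Proof.
move=> [D /countable_injP[f finj] Dd] x0.
have /choice[u uP] (i : nat) : exists x, forall y, D y -> f y = i -> x = y.
  have [[x [Dx xi]]|nx] := pselect (exists x, D x /\ f x = i).
    by exists x => y Dy yi; apply: finj; rewrite ?inE// xi yi.
  by exists x0 => y Dy yi; case: nx; exists y.
exists u => x V /(dense_nbhs Dd)[y Dy Vy].
by exists (f y); rewrite (uP _ y).
Qed.

Lemma countable_base (R : realType) (T : topologicalType) : polish_space R T ->
  exists O : nat * nat -> set T, forall (x : T) V, nbhs x V ->
    exists i, O i x /\ O i `<=` V.
Proof.
move=> [Ts /completely_metrizable_pseudometric[rho [[rho0 rhoC rhoD] rhoP _]]].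
have [[x0 _]|T0] := pselect (exists x : T, True); last first.
  by exists (fun=> setT) => x; case: T0; exists x.
have [u uP] := dense_sequence Ts x0.
exists (fun i => [set x | rho (u i.1) x < 2^-1 ^+ i.2]) => x V /rhoP[e e0 eV].
have [|n ne] := @half_expr_lt R (e / 2); first by rewrite divr_gt0.
have : nbhs x [set y | rho x y < 2^-1 ^+ n].
  by apply/rhoP; exists (2^-1 ^+ n) => //; rewrite exprn_gt0.
move=> /uP[i /= xi]; exists (i, n); rewrite /= rhoC; split => // y /= iy.
by apply: eV; have := rhoD x (u i) y; lra.
Qed.

Section truncation.
Context {R : realType}.

Definition truncate (x : \bar R) : R := if x is r%:E then Num.min 1 r else 1.

Lemma truncate_itv (x : \bar R) : (0 <= x)%E -> 0 <= truncate x <= 1.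
Proof.
case: x => [r| |]//=; last by rewrite ler01 lexx.
by rewrite lee_fin => r0; rewrite le_min ler01 r0 ge_min lexx.
Qed.

Lemma truncate_le (x y e : \bar R) : (0 <= e)%E -> (0 <= x)%E -> (0 <= y)%E ->
  (x <= e + y)%E -> (y <= e + x)%E -> (`|truncate x - truncate y|%:E <= e)%E.
Proof.
case: x => [x| |]//; case: y => [y| |]//; case: e => [e| |]//=;
  rewrite ?leey ?lee_fin ?subrr ?normr0//.
move=> e0 x0 y0 xy yx.
by case: (leP 1 x) => ?; case: (leP 1 y) => ?; rewrite ler_norml; lra.
Qed.

End truncation.

(** The functions [min(1, phi(-, a))] are continuous, 1-Lipschitz for [d], and detect its small
    values. To keep only countably many, one function is chosen for each pair of basic open sets and
    each threshold, among those whose values on the two sets differ by more than the threshold. *)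
Lemma label_family (R : realType) (X : topologicalType) (d : X -> X -> \bar R)
    (Phi : set (X -> X -> \bar R)) :
  polish_space R X -> pseudometric d ->
  (forall phi, Phi phi -> pseudometric phi) ->
  (forall phi, Phi phi -> continuous (fun p : X * X => phi p.1 p.2)) ->
  (forall x y : X, d x y = ereal_sup [set phi x y | phi in Phi]) ->
  exists h : nat -> X -> R,
  [/\ forall m z, 0 <= h m z <= 1,
      forall m z e, 0 < e -> nbhs z [set w | `|h m z - h m w| < e],
      forall m z w, (`|h m z - h m w|%:E <= d z w)%E
    & forall n z w, (forall m, `|h m z - h m w| <= n.+2%:R^-1) ->
        (d z w <= n.+2%:R^-1%:E)%E].
Proof.
move=> Xp [d_ge0 _ _ _] Phi_pm Phi_cont dE.
pose H := [set h : X -> R | [/\ forall z, 0 <= h z <= 1,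
  forall z e, 0 < e -> nbhs z [set w | `|h z - h w| < e]
  & forall z w, (`|h z - h w|%:E <= d z w)%E]].
have H0 : H (fun=> 0).
  split => [z|z e e0|z w]; rewrite ?lexx ?ler01// subrr normr0//.
  by apply: filterS filterT => w _ /=; rewrite ?subrr ?normr0.
have HPhi phi a : Phi phi -> H (fun z => truncate (phi z a)).
  move=> Pphi; have [p0 pxx pC pD] := Phi_pm _ Pphi.
  have lip z w : (`|truncate (phi z a) - truncate (phi w a)|%:E <= phi z w)%E.
    by apply: truncate_le => //; rewrite (pC z w).
  split=> [z|z e e0|z w]; first exact: truncate_itv.
  - have : nbhs (phi z z) [set x | (x < e%:E)%E].
      apply: open_nbhs_nbhs; split; first exact: open_ereal_lt_ereal.
      by rewrite /= pxx lte_fin.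
    move=> /(Phi_cont _ Pphi (z, z))[[A B]/= [Az Bz] AB].
    apply: filterS Bz => w Bw; rewrite /= -lte_fin.
    apply: le_lt_trans (lip z w) _; apply: (AB (z, w)); split => //=.
    exact: nbhs_singleton.
  - by rewrite dE; apply: le_trans (lip z w) _; apply: ereal_sup_ubound; exists phi.
have [B BP] := countable_base Xp.
pose Q (i : nat * nat * (nat * nat) * nat) (h : X -> R) :=
  forall z w, B i.1.1 z -> B i.1.2 w -> i.2.+2%:R^-1 < `|h z - h w|.
have /choice[f fP] i : exists h, H h /\ forall h', H h' -> Q i h' -> Q i h.
  have [[h Hh Qh]|nh] := pselect (exists2 h, H h & Q i h); first by exists h.
  by exists (fun=> 0); split => // h' Hh' Qh'; case: nh; exists h'.
pose h m := if unpickle m is Some i then f i else fun=> 0.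
have Hh m : H (h m) by rewrite /h; case: unpickle => [i|//]; have [] := fP i.
exists h; split => [m|m|m|n z w hn].
- by have [] := Hh m.
- by have [] := Hh m.
- by have [] := Hh m.
rewrite leNgt dE; apply/negP => /ereal_sup_gt[_ [phi Pphi <-] nphi].
pose k z := truncate (phi z w).
have Hk : H k := HPhi phi w Pphi; have [_ kc _] := Hk.
(* Truncation at 1 does no harm as [n.+2%:R^-1 < 1]; this is why thresholds start at one half. *)
have kzw : n.+2%:R^-1 < `|k z - k w|.
  have [p0 pxx _ _] := Phi_pm _ Pphi.
  rewrite /k pxx /= min_r// subr0; case: (phi z w) nphi (p0 z w) => [r| |]//=.
    rewrite !lte_fin lee_fin => nr r0; rewrite ger0_norm ?le_min ?ler01//.
    by rewrite lt_min nr invf_lt1// ltr1n.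
  by move=> _ _; rewrite normr1 invf_lt1// ltr1n.
(* Half of the excess: moving both [z] and [w] within [e] for [k] keeps the gap above the
   threshold. *)
pose e := (`|k z - k w| - n.+2%:R^-1) / 2.
have e0 : 0 < e by rewrite divr_gt0// subr_gt0.
have [i [iz iV]] := BP _ _ (kc z e e0); have [j [jw jV]] := BP _ _ (kc w e e0).
have Qk : Q (i, j, n) k.
  move=> a b /iV/= za /jV/= wb.
  have : `|k z - k w| <= `|k z - k a| + `|k a - k b| + `|k w - k b|.
    rewrite (distrC (k w)) -addrA; apply: le_trans (ler_distD (k a) _ _) _.
    by rewrite lerD2l ler_distD.
  by rewrite /=; move: za wb; rewrite /e; set q := n.+2%:R^-1; lra.
have := hn (pickle (i, j, n)); rewrite /h pickleK leNgt => /negP; apply.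
by have [_ /(_ k Hk Qk)] := fP (i, j, n); apply.
Qed.

(** * The coding space *)

Section coding_space.
Context {R : realType} {G : topologicalGroupType} {X : topologicalType}.
Variables (D : G -> G -> R) (h : nat -> X -> R).
Hypothesis D_compat : compatible_left_invariant D.
Hypothesis h_itv : forall m z, 0 <= h m z <= 1.
Hypothesis h_cont : forall m z e, 0 < e -> nbhs z [set w | `|h m z - h m w| < e].

(* Layers 0 and 1 carry no information: they are landmarks from which the
   positions of all points can be recovered. *)
Definition layer_base (k : nat) : R := if k is k'.+1 then 10 * k'%:R + 5 else 0.

Definition layer_label (k : nat) (z : X) : R :=
  if k is k'.+2 then h (logn 2 k') z else 0.

(** The cap at 1 keeps this term below the gaps between layers, while the factor [2 ^+ k'] turns a
    value below 1 into a bound on [D]. *)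
Definition layer_dist (k : nat) (g g' : G) : R :=
  if k is k'.+2 then Num.min 1 (2 ^+ k' * D g g') else 0.

Definition position (p : G * nat * X) : R :=
  layer_base p.1.2 + layer_label p.1.2 p.2.

Definition coding_dist (p q : G * nat * X) : R :=
  `|position p - position q| + layer_dist (minn p.1.2 q.1.2) p.1.1 q.1.1.

Lemma layer_label_itv k z : 0 <= layer_label k z <= 1.
Proof. by case: k => [|[|k]] /=; rewrite ?lexx ?ler01. Qed.

Lemma position_gap p q : (p.1.2 < q.1.2)%N -> position p + 4 <= position q.
Proof.
case: p q => [[g i] z] [[g' j] w] /=; rewrite /position/=.
have := layer_label_itv j w; case: i => [|[|i]]; case: j => [|[|j]]//=; try lra.
- have : (0 : R) <= j.+1%:R by [].
  lra.
- rewrite -(natr1 j); have : (0 : R) <= j%:R by []. lra.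
- have := h_itv (logn 2 i) z; rewrite !ltnS => hi hj ij.
  have : (i.+1%:R : R) <= j%:R by rewrite ler_nat.
  by rewrite -!natr1; lra.
Qed.

(** Positions on layer 0 are 0, on layer 1 they are 5, and on layer [k >= 2] they lie between
    [10 (k - 1) + 5] and [10 (k - 1) + 6]. So the two landmarks are the only distinct layers less
    than 9 apart. *)
Lemma position_gap2 p q : (p.1.2 < q.1.2)%N -> (1 < q.1.2)%N ->
  position p + 9 <= position q.
Proof.
case: p q => [[g i] z] [[g' j] w] /=; rewrite /position/=.
have := layer_label_itv j w; case: i => [|[|i]]; case: j => [|[|j]]//=; try lra.
- rewrite -(natr1 j); have : (0 : R) <= j%:R by []. lra.
- rewrite -(natr1 j); have : (0 : R) <= j%:R by []. lra.
- have := h_itv (logn 2 i) z; rewrite !ltnS => hi hj ij _.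
  have : (i.+1%:R : R) <= j%:R by rewrite ler_nat.
  by rewrite -!natr1; lra.
Qed.

Let D0 g : D g g = 0. Proof. by case: D_compat => -[]. Qed.
Let DC g g' : D g g' = D g' g. Proof. by case: D_compat => -[]. Qed.
Let DD g g' g'' : D g g'' <= D g g' + D g' g''. Proof. by case: D_compat => -[]. Qed.
Let D_ge0 g g' : 0 <= D g g'.
Proof. by apply: real_pseudometric_ge0; case: D_compat. Qed.

Lemma layer_dist_itv k g g' : 0 <= layer_dist k g g' <= 1.
Proof.
case: k => [|[|k]] /=; rewrite ?lexx ?ler01//.
by rewrite le_min ler01 mulr_ge0//= ge_min lexx.
Qed.

Lemma layer_dist_pseudometric k : real_pseudometric (layer_dist k).
Proof.
split => [g|g g'|g g' g'']; case: k => [|[|k]] //=;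
  rewrite ?addr0 ?lexx//.
- by rewrite D0 mulr0 min_r.
- by rewrite DC.
- have : 2 ^+ k * D g g'' <= 2 ^+ k * D g g' + 2 ^+ k * D g' g''.
    by rewrite -mulrDr ler_wpM2l.
  have : 0 <= 2 ^+ k * D g g' by rewrite mulr_ge0.
  have : 0 <= 2 ^+ k * D g' g'' by rewrite mulr_ge0.
  set a := _ * D g g'; set b := _ * D g' g''; set c := _ * _ => b0 a0 cab.
  by case: (leP 1 a) => ?; case: (leP 1 b) => ?; case: (leP 1 c) => ?; lra.
Qed.

Lemma layer_dist_le i j g g' : (i <= j)%N -> layer_dist i g g' <= layer_dist j g g'.
Proof.
case: i => [|[|i]]; try by case/andP: (layer_dist_itv j g g').
case: j => [|[|j]]// ij /=; rewrite le_min ge_min lexx/= ge_min; apply/orP; right.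
by rewrite ler_wpM2r// ler_weXn2l// ler1n.
Qed.

Lemma coding_dist_pseudometric : real_pseudometric coding_dist.
Proof.
split => [p|p q|p q r].
- rewrite /coding_dist subrr normr0 add0r.
  by have [->] := layer_dist_pseudometric (minn p.1.2 p.1.2).
- rewrite /coding_dist distrC minnC; congr (_ + _).
  by have [_ ->] := layer_dist_pseudometric (minn q.1.2 p.1.2).
- rewrite /coding_dist.
  have [_ _ /(_ p.1.1 q.1.1 r.1.1)] := layer_dist_pseudometric (minn p.1.2 r.1.2).
  have := layer_dist_itv (minn p.1.2 r.1.2) p.1.1 r.1.1.
  have /andP[] := layer_dist_itv (minn p.1.2 q.1.2) p.1.1 q.1.1.
  have /andP[] := layer_dist_itv (minn q.1.2 r.1.2) q.1.1 r.1.1.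
  (* If [q] is not below both other layers, monotonicity of [layer_dist] in the layer suffices.
     Otherwise the detour through [q] lengthens the path along the line by more than 1, which pays
     for the capped term. *)
  have [pr|] := leqP (minn p.1.2 r.1.2) q.1.2.
    have := @layer_dist_le (minn p.1.2 r.1.2) (minn p.1.2 q.1.2) p.1.1 q.1.1.
    have := @layer_dist_le (minn p.1.2 r.1.2) (minn q.1.2 r.1.2) q.1.1 r.1.1.
    rewrite !leq_min pr geq_minl geq_minr => /(_ isT) + /(_ isT).
    by have := ler_distD (position q) (position p) (position r); lra.
  rewrite leq_min => /andP[/position_gap qp /position_gap qr].
  rewrite (distrC (position q)) !(@ger0_norm _ (_ - position q)); try lra.
  have : `|position p - position r| <=
      position p - position q + (position r - position q) - 1.
    by rewrite ler_norml; lra.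
  lra.
Qed.

Lemma coding_dist_dense : separable_space G -> separable_space X -> X ->
  exists z : nat -> G * nat * X, forall p e, 0 < e ->
    exists i, coding_dist p (z i) < e.
Proof.
move=> /dense_sequence/(_ 1%g)[u uP] /dense_sequence vP /vP{vP}[v vP].
pose z (i : nat) := if unpickle i is Some (a, k, b) then (u a, k, v b)
  else (1%g, 0%N, v 0%N) : G * nat * X.
exists z => -[[g k] x] e e0; have e20 : 0 < e / 2 by rewrite divr_gt0.
have [a ga] : exists a, layer_dist k g (u a) < e / 2.
  case: k => [|[|k]] /=; [by exists 0%N..|].
  have [_ _ Dn _] := D_compat.
  have [|a /= ga] := uP g [set g' | D g g' < e / 2 / 2 ^+ k].
    by apply: Dn; rewrite divr_gt0// exprn_gt0.
  exists a; rewrite gt_min; apply/orP; right.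
  by rewrite mulrC -ltr_pdivlMr// exprn_gt0.
have [b xb] : exists b, `|layer_label k x - layer_label k (v b)| < e / 2.
  case: k {ga} => [|[|k]] /=; try by exists 0%N; rewrite subrr normr0.
  exact: vP (h_cont _ _ e20).
exists (pickle (a, k, b)); rewrite /z pickleK /coding_dist/position/= minnn.
by rewrite opprD addrACA subrr add0r; lra.
Qed.

Lemma coding_dist_translate a p q :
  coding_dist ((a * p.1.1)%g, p.1.2, p.2) ((a * q.1.1)%g, q.1.2, q.2) =
  coding_dist p q.
Proof.
rewrite /coding_dist/position/=; congr (_ + _).
by case: (minn _ _) => [|[|k]]//=; have [_ ->] := D_compat.
Qed.

(** Within one layer, label and [layer_dist] contribute at most 1 each; for distinct layers other
    than the landmarks [position_gap2] gives at least 9. *)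
Lemma coding_dist_landmarks p q : 2 < coding_dist p q < 9 ->
  p.1.2 = 0%N /\ q.1.2 = 1%N \/ p.1.2 = 1%N /\ q.1.2 = 0%N.
Proof.
wlog pq : p q / (p.1.2 <= q.1.2)%N.
  move=> wl pq; have [/wl|/ltnW/wl] := leqP p.1.2 q.1.2; first exact.
  have [_ dC _] := coding_dist_pseudometric.
  by rewrite dC => /(_ pq)[[? ?]|[? ?]]; [right|left].
have := layer_dist_itv (minn p.1.2 q.1.2) p.1.1 q.1.1; rewrite /coding_dist.
move: pq; rewrite leq_eqVlt => /orP[/eqP|] pq.
  rewrite /position pq opprD addrACA subrr add0r.
  have := layer_label_itv q.1.2 p.2; have := layer_label_itv q.1.2 q.2.
  set a := layer_label _ _; set b := layer_label _ p.2 => a01 b01.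
  have ba : `|b - a| <= 1 by rewrite ler_norml; lra.
  by move=> e01 dpq; clear pq; exfalso; lra.
have [q1|q1] := ltnP 1 q.1.2.
  have := position_gap2 pq q1; rewrite distrC => gap.
  by rewrite ger0_norm => [e01 dpq|]; [exfalso|]; lra.
by move=> _ _; left; move: pq q1; case: p.1.2 => [|?]; case: q.1.2 => [|[|?]].
Qed.

End coding_space.

(** * Decoding a pair of codes that are close to each other *)

Section decoding.
Context {R : realType} {G : topologicalGroupType} {X : topologicalType}.
Variables (D : G -> G -> R) (h : nat -> X -> R) (act : G -> X -> X).
Hypothesis G_complete : completely_metrizable R G.
Hypothesis D_compat : compatible_left_invariant D.
Hypothesis h_itv : forall m z, 0 <= h m z <= 1.
Hypothesis h_cont : forall m z e, 0 < e -> nbhs z [set w | `|h m z - h m w| < e].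
Hypothesis act_cont : continuous_action act.

Definition orbit_code (x : X) (p : G * nat) : G * nat * X :=
  (p, act (p.1^-1)%g x).

Local Notation pos x p := (position (R := R) h (orbit_code x p)).
Local Notation dist x p q := (coding_dist D h (orbit_code x p) (orbit_code x q)).

Lemma dist_landmark x p : dist x (1%g, 0%N) p = pos x p.
Proof.
rewrite /coding_dist/= min0n addr0 /position/= add0r sub0r normrN ger0_norm//.
have /andP[? _] := layer_label_itv h_itv p.2 (act p.1^-1%g x).
by rewrite addr_ge0//; case: p.2 => //= k.
Qed.

Lemma nbhs_label m x g e : 0 < e ->
  nbhs g [set g' | `|h m (act g^-1%g x) - h m (act g'^-1%g x)| < e].
Proof.
move=> e0; have [_ _ cact] := act_cont.
have := cact (g^-1%g, x) _ (h_cont m (act g^-1%g x) e0).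
move=> [[A B] /= [Ag Bx] AB].
have gA : nbhs g [set g' | A (g'^-1)%g] := @invg_continuous G g A Ag.
apply: filterS gA => g' Ag'; apply: (AB (g'^-1%g, x)); split => //=.
exact: nbhs_singleton.
Qed.

Variables (M : metricType R) (x y : X) (alpha beta : G * nat -> M) (c : R).
Hypothesis c_le : 8 * c <= 1.
Hypothesis alphaE : forall p q, mdist (alpha p) (alpha q) = dist x p q.
Hypothesis betaE : forall p q, mdist (beta p) (beta q) = dist y p q.
Hypothesis alpha_near : forall p, exists q, mdist (alpha p) (beta q) < c.
Hypothesis beta_near : forall q, exists p, mdist (alpha p) (beta q) < c.

Lemma near_dist p q p' q' : mdist (alpha p) (beta q) < c ->
  mdist (alpha p') (beta q') < c -> `|dist x p p' - dist y q q'| < 2 * c.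
Proof.
move=> pq pq'; rewrite -alphaE -betaE.
have := metric_triangle (alpha p) (beta q) (alpha p').
have := metric_triangle (beta q) (beta q') (alpha p').
have := metric_triangle (beta q) (alpha p) (beta q').
have := metric_triangle (alpha p) (alpha p') (beta q').
rewrite (metric_sym (beta q) (alpha p)) (metric_sym (beta q') (alpha p')).
by rewrite ltr_norml; lra.
Qed.

(** The landmarks are 5 apart, so their partners are landmarks too. That they are not swapped is
    seen from a third point on layer 2, which is farther from landmark 0 than from landmark 1. *)
Lemma near_landmark q : mdist (alpha (1%g, 0%N)) (beta q) < c -> q.2 = 0%N.
Proof.
move=> pq; have [q' pq'] := alpha_near (1%g, 1%N).
have [r pr] := alpha_near (1%g, 2%N).
have := near_dist pq pq'; have := near_dist pq pr; have := near_dist pq' pr.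
rewrite !dist_landmark.
have -> : dist x (1%g, 1%N) (1%g, 2%N) = pos x (1%g, 2%N) - 5.
  rewrite /coding_dist/position/=.
  have := h_itv (logn 2 0) (act (1^-1)%g x) => h01.
  rewrite !mulr1 !mulr0 !addr0 add0r distrC; rewrite ger0_norm; lra.
have -> : pos x (1%g, 1%N) = 5 by rewrite /position/= mulr0 add0r addr0.
have : 15 <= pos x (1%g, 2%N).
  by rewrite /position/=; have := h_itv (logn 2 0) (act (1^-1)%g x); lra.
set P := pos x _ => P15 q'r qr qq'.
have /(coding_dist_landmarks D_compat h_itv) : 2 < dist y q q' < 9.
  by move: qq'; rewrite ltr_norml; have := c_le; lra.
(* In the swapped case [r] would have position about [P - 5], as seen from [q'], and yet be about
   [P] away from position 5, which is impossible for [P >= 15]. *)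
case=> [[->//]|[/= q1 q0]]; exfalso.
have E : q' = (q'.1, 0%N) by rewrite -q0; case: (q').
have Dq'r : dist y q' r = pos y r.
  rewrite -dist_landmark /coding_dist/= q0 !min0n/=.
  by rewrite /position/= q0.
have Dqr : dist y q r <= `|5 - pos y r| + 0.
  rewrite /coding_dist/= q1; rewrite {1}/position/= q1 /= mulr0 add0r addr0.
  by rewrite lerD2l; case: r.2 => [|[|?]].
have r0 : 0 <= pos y r.
  by rewrite -dist_landmark; apply/real_pseudometric_ge0/coding_dist_pseudometric.
move: q'r qr; rewrite Dq'r !ltr_norml => /andP[? ?] /andP[? ?].
by move: Dqr; have := c_le; case: (ger0P (5 - pos y r)) => ? ?; lra.
Qed.

Lemma near_position p q : mdist (alpha p) (beta q) < c ->
  `|pos x p - pos y q| < 2 * c.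
Proof.
move=> pq; have [r pr] := alpha_near (1%g, 0%N); have r0 := near_landmark pr.
have := near_dist pr pq; rewrite dist_landmark.
suff -> : dist y r q = pos y q by [].
by rewrite -dist_landmark /coding_dist/= r0 !min0n/= /position/= r0.
Qed.

Lemma near_layer p q : mdist (alpha p) (beta q) < c -> p.2 = q.2.
Proof.
move=> /near_position; rewrite ltr_norml => /andP[? ?].
case: (ltngtP p.2 q.2) => // pq; exfalso.
- have := @position_gap R G X h h_itv (orbit_code x p) (orbit_code y q) pq.
  by have := c_le; lra.
- have := @position_gap R G X h h_itv (orbit_code y q) (orbit_code x p) pq.
  by have := c_le; lra.
Qed.

(** The total distances differ by less than [2 * c] and each of the two positions is off by less
    than [2 * c]. *)
Lemma near_layer_dist p q p' q' : mdist (alpha p) (beta q) < c ->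
  mdist (alpha p') (beta q') < c ->
  `|layer_dist D (minn p.2 p'.2) p.1 p'.1 -
    layer_dist D (minn p.2 p'.2) q.1 q'.1| < 6 * c.
Proof.
move=> pq pq'; have := near_dist pq pq'.
rewrite {1 2}/coding_dist/= -(near_layer pq) -(near_layer pq').
have := near_position pq; have := near_position pq'.
set a := pos x p; set b := pos x p'; set a' := pos y q; set b' := pos y q'.
move: (layer_dist _ _ _ _) (layer_dist _ _ _ _) => s s' bb' aa'.
have : `| `|a - b| - `|a' - b'| | < 4 * c.
  apply: le_lt_trans (ler_dist_dist _ _) _.
  have -> : a - b - (a' - b') = (a - a') - (b - b') by lra.
  by apply: le_lt_trans (ler_normB _ _) _; lra.
by rewrite !ltr_norml; lra.
Qed.

Lemma layer_dist_lt k g g' : layer_dist D k.+2 g g' < 1 -> D g g' < 2^-1 ^+ k.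
Proof.
rewrite /= gt_min ltxx/= => lt1.
by rewrite exprVn -[ltRHS]mul1r ltr_pdivlMr ?exprn_gt0// mulrC.
Qed.

(** Partners lie on the same layer, so closeness on layer [k.+2] is a relation on [G], total on both
    sides. Two partners of one element have [layer_dist] below [6 * c < 1], hence [D]-distance below
    [2^-1 ^+ k], as [back_and_forth] requires. *)
Lemma decode : exists g t, forall m,
  `|h m (act g^-1%g x) - h m (act t^-1%g y)| <= 2 * c.
Proof.
pose Rel k g t := mdist (alpha (g, k.+2)) (beta (t, k.+2)) < c.
have [k g|k t|k k' g t t' kk' gt gt'|k k' g g' t kk' gt gt'|g [t gtP]] :=
    back_and_forth (K := fun m k => logn 2 k = m) (Rel := Rel)
      G_complete D_compat logn2_cofinal.
- have [[t k'] gt] := alpha_near (g, k.+2); exists t.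
  by have /= kk' := near_layer gt; rewrite /Rel {2}kk'.
- have [[g k'] gt] := beta_near (t, k.+2); exists g.
  by have /= kk' := near_layer gt; rewrite /Rel -{1}kk'.
- have := near_layer_dist gt gt'.
  rewrite /= (minn_idPl _)//; have [-> _ _] := layer_dist_pseudometric D_compat k.+2.
  rewrite sub0r normrN ltr_norml => lt6c.
  by apply: layer_dist_lt; have := c_le; lra.
- have := near_layer_dist gt gt'.
  rewrite /= (minn_idPl _)//; have [-> _ _] := layer_dist_pseudometric D_compat k.+2.
  rewrite subr0 ltr_norml => lt6c.
  by apply: layer_dist_lt; have := c_le; lra.
exists g, t => m; apply/ler_addgt0Pr => e e0.
have e20 : 0 < e / 2 by rewrite divr_gt0.
(* Layer [k.+2] displays label [m], and on one layer positions differ exactly as labels do;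
   continuity of the label carries the bound from [g'], [t'] to [g], [t]. *)
have [k [g' [t' [km /= gg' tt' gt']]]] :=
  gtP m _ _ (nbhs_label m x g e20) (nbhs_label m y t e20).
have := near_position gt'; rewrite /position/= km opprD addrACA subrr add0r.
move: gg' tt'; rewrite !ltr_norml ler_norml.
by lra.
Qed.

End decoding.

(** * The Wijsman topology *)

Section distance_to_sets.
Context {R : realType} {M : metricType R}.
Implicit Types (x y : M) (A B : set M).

Lemma dist_to_set_le x a A : A a -> dist_to_set x A <= mdist x a.
Proof.
move=> Aa; apply: ge_inf; last by exists a.
by exists 0 => _ [b _ <-]; exact: mdist_ge0.
Qed.

Lemma dist_to_set_lt x A (r : R) : A !=set0 -> dist_to_set x A < r ->
  exists2 a, A a & mdist x a < r.
Proof.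
move=> [b Ab] xAr; have [|_ [a Aa <-] xa] := inf_lt _ xAr; last by exists a.
by exists (mdist x b), b.
Qed.

Lemma dist_to_set_lip x y A : A !=set0 ->
  dist_to_set x A <= mdist x y + dist_to_set y A.
Proof.
move=> [b Ab]; rewrite -lerBlDl; apply: lb_le_inf.
  by exists (mdist y b), b.
move=> _ [a Aa <-]; rewrite lerBlDl.
exact: le_trans (dist_to_set_le _ Aa) (metric_triangle _ _ _).
Qed.

Lemma hausdorff_dist_le A B (r : R) :
  (forall a, A a -> dist_to_set a B <= r) ->
  (forall b, B b -> dist_to_set b A <= r) -> (hausdorff_dist A B <= r%:E)%E.
Proof.
move=> AB BA; rewrite /hausdorff_dist ge_max; apply/andP.
by split; apply: ge_ereal_sup => _ [a ? <-]; rewrite lee_fin; auto.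
Qed.

Lemma hausdorff_dist_lt A B (r : R) : A !=set0 -> B !=set0 ->
  (hausdorff_dist A B < r%:E)%E ->
  (forall a, A a -> exists2 b, B b & mdist a b < r) /\
  (forall b, B b -> exists2 a, A a & mdist b a < r).
Proof.
move=> A0 B0; rewrite /hausdorff_dist gt_max => /andP[AB BA].
split=> [a Aa|b Bb]; apply: dist_to_set_lt => //; rewrite -lte_fin.
  by apply: le_lt_trans AB; apply: ereal_sup_ubound; exists a.
by apply: le_lt_trans BA; apply: ereal_sup_ubound; exists b.
Qed.

End distance_to_sets.

Section borel_sets.
Context {X : topologicalType}.
Local Notation borel := (<<s (@open X) >>).

Lemma borel_open (A : set X) : open A -> borel A.
Proof. exact: sub_sigma_algebra. Qed.

Lemma borel0 : borel set0.
Proof. by apply: borel_open; exact: open0. Qed.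

Lemma borelC (A : set X) : borel A -> borel (~` A).
Proof. by move=> bA; rewrite -setTD; exact: sigma_algebraCD. Qed.

Lemma borel_bigcup (A : nat -> set X) : (forall i, borel (A i)) ->
  borel (\bigcup_i A i).
Proof. exact: sigma_algebra_bigcup. Qed.

Lemma borelU (A B : set X) : borel A -> borel B -> borel (A `|` B).
Proof.
move=> bA bB; rewrite -bigcup2E; apply: borel_bigcup => -[|[|i]] //=.
exact: borel0.
Qed.

Lemma borelI (A B : set X) : borel A -> borel B -> borel (A `&` B).
Proof.
move=> bA bB; rewrite -[_ `&` _]setCK setCI; apply: borelC.
by apply: borelU; apply: borelC.
Qed.

Lemma borel_map_open (Y : topologicalType) (f : X -> Y) :
  (forall W, open W -> borel (f @^-1` W)) -> borel_map f.
Proof.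
move=> fo; apply: smallest_sub => //; split.
- by rewrite /= preimage_set0; exact: borel0.
- by move=> A bA; rewrite /= setTD preimage_setC; exact: borelC.
- by move=> A bA; rewrite /= preimage_bigcup; exact: borel_bigcup.
Qed.

End borel_sets.

Section wijsman.
Context {R : realType} {U : metricType R}.
Variables (v : nat -> U).
Hypothesis v_dense : forall (x : U) V, nbhs x V -> exists i, V (v i).

(** The index is a finite list of natural and rational data, so these sets can be enumerated by
    [pickle]. *)
Definition wijsman_basic (s : seq (nat * rat * nat)) : set (closed_nonempty U) :=
  [set F | forall i, i \in s -> `|wijsman_dist (v i.1.1) F - ratr i.1.2| < 2^-1 ^+ i.2].

Lemma wijsman_base (W : set (closed_nonempty U)) F : nbhs F W ->
  exists2 s, wijsman_basic s F & wijsman_basic s `<=` W.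
Proof.
pose B := filter_from (wijsman_basic^~ F) wijsman_basic.
have BF : Filter B.
  apply: filter_from_filter; first by exists [::].
  move=> s t sF tF; exists (s ++ t).
    by move=> i; rewrite mem_cat => /orP[/sF|/tF].
  move=> E stE; split => i ii; apply: stE; rewrite mem_cat ii ?orbT//.
suff : B --> F by move=> /[apply] -[s sF sW]; exists s.
apply/cvg_sup => u A.
rewrite (@nbhsE (initial_topology (@wijsman_dist R U u))).
move=> [_ [[V Vo <-] /= VF] VA].
have /nbhs_ballP[e /= e0 eV] : nbhs (wijsman_dist u F) V by exact: open_nbhs_nbhs.
(* Four errors add up: twice the distance from [u] to [v i], and once each the distances of [F] and
   [E] from [q]. *)
have e80 : 0 < e / 8 by rewrite divr_gt0.
have [i ui] := v_dense (nbhs_mdist_lt u e80).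
have [n ne] := half_expr_lt e80.
have [q] := @rat_in_itvoo R (wijsman_dist (v i) F)
  (wijsman_dist (v i) F + 2^-1 ^+ n) ltac:(by rewrite ltrDl exprn_gt0).
rewrite in_itv/= => /andP[q1 q2].
exists [:: (i, q, n)].
  by move=> j; rewrite inE => /eqP->/=; rewrite ltr_norml; lra.
move=> E /(_ (i, q, n)); rewrite inE eqxx => /(_ isT)/= Eq.
apply: VA; apply: eV; rewrite /ball/=.
have lip (H : closed_nonempty U) x y :
    wijsman_dist x H <= mdist x y + wijsman_dist y H.
  by apply: dist_to_set_lip; have [_] := svalP H.
have := lip F u (v i); have := lip E u (v i).
have := lip F (v i) u; have := lip E (v i) u; rewrite (metric_sym (v i)).
move: Eq ui; rewrite /= !ltr_norml.
by lra.
Qed.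

(** Semicontinuity suffices: strict lower bounds on the distance then define countable unions of
    closed sets, and every open set of the hyperspace is a countable union of basic ones. *)
Lemma wijsman_borel (X : topologicalType) (F : X -> closed_nonempty U) :
  (forall u (r : R), open [set x | wijsman_dist u (F x) < r]) -> borel_map F.
Proof.
move=> Fo; apply: borel_map_open => W Wo.
have gt_borel u (r : R) : <<s open >> [set x | r < wijsman_dist u (F x)].
  have -> : [set x | r < wijsman_dist u (F x)] =
      \bigcup_n ~` [set x | wijsman_dist u (F x) < r + 2^-1 ^+ n].
    apply/seteqP; split=> x /=.
      rewrite -subr_gt0 => /half_expr_lt[n nr]; exists n => //=.
      by apply/negP; rewrite -leNgt; lra.
    move=> [n _ /= /negP]; rewrite -leNgt; apply: lt_le_trans.
    by rewrite ltrDl exprn_gt0.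
  by apply: borel_bigcup => n; apply: borelC; apply: borel_open.
have basic_borel s : <<s open >> (F @^-1` wijsman_basic s).
  elim: s => [|i s IH].
    rewrite (_ : _ @^-1` _ = setT); first by apply: borel_open; exact: openT.
    by apply/seteqP; split.
  rewrite (_ : _ @^-1` _ =
    [set x | wijsman_dist (v i.1.1) (F x) < ratr i.1.2 + 2^-1 ^+ i.2] `&`
    [set x | ratr i.1.2 - 2^-1 ^+ i.2 < wijsman_dist (v i.1.1) (F x)] `&`
    (F @^-1` wijsman_basic s)).
    by apply: borelI => //; apply: borelI => //; exact: borel_open.
  apply/seteqP; split=> x /=.
    move=> Fx; have := Fx i (mem_head _ _); rewrite ltr_norml => ?.
    split; first by split; lra.
    by move=> j js; apply: Fx; rewrite inE js orbT.
  move=> [[? ?] Fx] j; rewrite inE => /orP[/eqP->|/Fx//].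
  by rewrite ltr_norml; lra.
pose A n : set X := if unpickle n is Some s then
  if pselect (wijsman_basic s `<=` W) then F @^-1` wijsman_basic s else set0
  else set0.
have -> : F @^-1` W = \bigcup_n A n.
  apply/seteqP; split=> x /=.
    move=> Wx; have [|s sF sW] := @wijsman_base W (F x); first exact: open_nbhs_nbhs.
    by exists (pickle s) => //; rewrite /A pickleK; case: pselect.
  move=> [n _]; rewrite /A; case: unpickle => // s; case: pselect => // sW.
  exact: sW.
apply: borel_bigcup => n; rewrite /A; case: unpickle => [s|]; last exact: borel0.
by case: pselect => a; [exact: basic_borel|exact: borel0].
Qed.

End wijsman.

(** * The reduction *)

Section reduction.
Context {R : realType} {G : topologicalGroupType} {X : topologicalType}.
Context {U : metricType R}.
Variables (D : G -> G -> R) (h : nat -> X -> R) (act : G -> X -> X).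
Variable iota : G * nat * X -> U.
Hypothesis D_compat : compatible_left_invariant D.
Hypothesis h_itv : forall m z, 0 <= h m z <= 1.
Hypothesis h_cont : forall m z e, 0 < e -> nbhs z [set w | `|h m z - h m w| < e].
Hypothesis act_cont : continuous_action act.
Hypothesis iotaE : forall p q, mdist (iota p) (iota q) = coding_dist D h p q.

Definition orbit_points (x : X) : set U := range (iota \o orbit_code act x).

Lemma orbit_points_closed x :
  closed (closure (orbit_points x)) /\ closure (orbit_points x) !=set0.
Proof.
split; first exact: closed_closure.
exists (iota (orbit_code act x (1%g, 0%N))); apply: subset_closure.
by exists (1%g, 0%N).
Qed.

Definition orbit_closed (x : X) : closed_nonempty U :=
  exist _ (closure (orbit_points x)) (orbit_points_closed x).

Lemma coding_dist_labels g k z w :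
  coding_dist D h (g, k, z) (g, k, w) = `|layer_label h k z - layer_label h k w|.
Proof.
rewrite /coding_dist /position/=.
have [-> _ _] := layer_dist_pseudometric D_compat (minn k k).
by rewrite addr0 opprD addrACA subrr add0r.
Qed.

(** With [(g, k)] fixed, the code point over it moves continuously with [x], so a point of the code
    of [x] near [u] has counterparts near [u] for all nearby [x']. *)
Lemma wijsman_orbit_open u (r : R) :
  open [set x | wijsman_dist u (orbit_closed x) < r].
Proof.
rewrite openE => x /= /dist_to_set_lt[|a xa ua].
  by have [_] := orbit_points_closed x.
have a0 : 0 < (r - mdist u a) / 2 by rewrite divr_gt0// subr_gt0.
have [_ [[g k] _ <-] /= aq] := (closure_mdistP _ _).1 xa _ a0.
set q := iota _ in aq.
have : nbhs x [set x' | `|layer_label h k (act g^-1%g x) -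
    layer_label h k (act g^-1%g x')| < (r - mdist u a) / 2].
  case: k {q aq} => [|[|k]] /=;
    try by apply: filterS filterT => w _ /=; rewrite subrr normr0.
  have [_ _ cact] := act_cont.
  have := cact (g^-1%g, x) _ (h_cont (logn 2 k) (act g^-1%g x) a0).
  move=> [[A B] /= [Ag Bx] AB]; apply: filterS Bx => x' Bx'.
  by apply: (AB (g^-1%g, x')); split => //=; exact: nbhs_singleton.
apply: filterS => x' /=; rewrite -(coding_dist_labels g k) -iotaE -/q => qq'.
have : closure (orbit_points x') (iota (orbit_code act x' (g, k))).
  by apply: subset_closure; exists (g, k).
move=> /(dist_to_set_le u); rewrite /wijsman_dist/= => /le_lt_trans; apply.
have := metric_triangle u a q.
have := metric_triangle u q (iota (orbit_code act x' (g, k))).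
by move: qq'; rewrite /orbit_code /=; lra.
Qed.

Lemma orbit_closed_points x : exists2 e : G * nat -> sval (orbit_closed x),
  forall p, set_val (e p) = iota (orbit_code act x p) &
  forall (a : sval (orbit_closed x)) r, 0 < r -> exists p, mdist a (e p) < r.
Proof.
have /choice[e eE] p : exists a : sval (orbit_closed x),
    set_val a = iota (orbit_code act x p).
  have xp : closure (orbit_points x) (iota (orbit_code act x p)).
    by apply: subset_closure; exists p.
  by exists (SigSub (mem_set xp)).
exists e => // a r r0; have := set_valP a.
move=> /closure_mdistP/(_ r r0)[_ [p _ <-] ap].
by exists p; rewrite /mdist/= eE.
Qed.

(** Left translation by [g] preserves [coding_dist], so [isometry_extension] yields a second copy of
    the code of [x] in [U]. Its points share group coordinate and layer with points of the code of
    [y] and differ from them only in the label. *)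
Lemma gh_orbit_le x y g (c : R) : complete_space U ->
  (forall k t, `|layer_label h k (act t^-1%g x) -
    layer_label h k (act (g * t)^-1%g y)| <= c) ->
  (gh_closed_nonempty (orbit_closed x) (orbit_closed y) <= c%:E)%E.
Proof.
move=> Uc xyc.
have [a aE a_dense] := orbit_closed_points x.
have [b bE b_dense] := orbit_closed_points y.
pose a' p := iota ((g * p.1)%g, p.2, act p.1^-1%g x).
have a'E p q : mdist (a' p) (a' q) = mdist (a p) (a q).
  rewrite iotaE [RHS]/mdist/= !aE iotaE.
  exact: (coding_dist_translate _ D_compat g (orbit_code act x p) (orbit_code act x q)).
have [T TE Ta] := isometry_extension Uc
  (mdist_real_pseudometric (set_type (sval (orbit_closed x)))) a_dense a'E.
have Ta0 p : T (a p) = a' p by apply: mdist_positivity; rewrite Ta mdistxx.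
have near p : mdist (a' p) (set_val (b ((g * p.1)%g, p.2))) <= c.
  by rewrite bE iotaE coding_dist_labels.
apply: (@le_trans _ _ (hausdorff_dist (range T)
    (range (set_val : set_type (sval (orbit_closed y)) -> U)))).
  by apply: ereal_inf_lbound; exists U, T, set_val.
apply: hausdorff_dist_le => [_ [s _ <-]|_ [s _ <-]]; apply/ler_addgt0Pr => e e0.
  have [p sp] := a_dense s e e0.
  apply: le_trans (@dist_to_set_le _ _ _ (set_val (b ((g * p.1)%g, p.2))) _ _) _.
    by exists (b ((g * p.1)%g, p.2)).
  have := metric_triangle (T s) (a' p) (set_val (b ((g * p.1)%g, p.2))).
  by rewrite Ta; have := near p; lra.
have [[t k] sp] := b_dense s e e0.
apply: le_trans (@dist_to_set_le _ _ _ (T (a ((g^-1 * t)%g, k))) _ _) _.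
  by exists (a ((g^-1 * t)%g, k)).
have := near ((g^-1 * t)%g, k); rewrite /= mulVKg => near_t.
have := metric_triangle (set_val s) (set_val (b (t, k))) (a' ((g^-1 * t)%g, k)).
by rewrite Ta0 (metric_sym (set_val (b _))); move: sp; rewrite {1}/mdist/=; lra.
Qed.

(** The Hausdorff bound concerns closures; approximating by actual code points costs another [c], so
    [decode] is applied with [2 * c]. *)
Lemma gh_orbit_lt x y (c : R) : completely_metrizable R G ->
  0 < c -> 16 * c <= 1 ->
  (gh_closed_nonempty (orbit_closed x) (orbit_closed y) < c%:E)%E ->
  exists g t, forall m, `|h m (act g^-1%g x) - h m (act t^-1%g y)| <= 4 * c.
Proof.
move=> Gc c0 c1 /ereal_inf_lt[_ [Z [iM [iN [iM_isom iN_isom ->]]]]].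
have [a aE a_dense] := orbit_closed_points x.
have [b bE b_dense] := orbit_closed_points y.
have ne (T : Type) (f : G * nat -> T) (S : Type) (i : T -> S) : range i !=set0.
  by exists (i (f (1%g, 0%N))), (f (1%g, 0%N)).
move=> /(hausdorff_dist_lt (ne _ a _ iM) (ne _ b _ iN))[MN NM].
have -> : 4 * c = 2 * (2 * c) by lra.
apply: (@decode R G X D h act Gc D_compat h_itv h_cont act_cont Z x y
  (iM \o a) (iN \o b)).
- by lra.
- by move=> p q; rewrite /= iM_isom [LHS]/mdist/= !aE iotaE.
- by move=> p q; rewrite /= iN_isom [LHS]/mdist/= !bE iotaE.
- move=> p; have [|_ [s _ <-] ps] := MN (iM (a p)); first by exists (a p).
  have [q sq] := b_dense s c c0; exists q.
  have := metric_triangle (iM (a p)) (iN s) (iN (b q)).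
  by rewrite /= (iN_isom s); lra.
- move=> q; have [|_ [s _ <-] qs] := NM (iN (b q)); first by exists (b q).
  have [p sp] := a_dense s c c0; exists p.
  have := metric_triangle (iM (a p)) (iM s) (iN (b q)).
  by rewrite /= (iM_isom (a p)) (metric_sym (a p)) (metric_sym (iM s)); lra.
Qed.

End reduction.

Theorem theorem1p1 (R : realType) (G : topologicalGroupType)
    (X : topologicalType) (act : G -> X -> X) (d : X -> X -> \bar R)
    (Phi : set (X -> X -> \bar R)) (U : metricType R)
    (polishG : polish_space R G) (polishX : polish_space R X)
    (act_cont : continuous_action act)
    (d_pseudometric : pseudometric d)
    (d_lsc : lower_semicontinuous (fun p : X * X => d p.1 p.2))
    (d_invariant : forall (g : G) (x y : X), d x y = d (act g x) (act g y))
    (Phi_pseudometric : forall phi, Phi phi -> pseudometric phi)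
    (Phi_cont : forall phi, Phi phi ->
      continuous (fun p : X * X => phi p.1 p.2))
    (d_sup : forall x y : X, d x y = ereal_sup [set phi x y | phi in Phi])
    (urysohnU : urysohn_space U) :
  borel_uc_reducible (orbit_pseudometric act d) (@gh_closed_nonempty R U).
Proof.
have [Gs Gc] := polishG; have [Xs _] := polishX; have [Us Uc _] := urysohnU.
(* The dense sequence of the coding space needs a point of [X]; for empty [X] the empty map is a
   reduction. *)
have [[x0 _]|X0] := pselect (exists x : X, True); last first.
  exists (fun x => False_rect _ (X0 (ex_intro _ x I))).
    move=> B _; rewrite (_ : _ @^-1` _ = set0); first exact: borel0.
    by apply/seteqP; split => x //; case: X0; exists x.
  by move=> eps eps0; exists 1, 1; split => // x; case: X0; exists x.
have [D D_compat] := birkhoff_kakutani Gc.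
have [h [h_itv h_cont h_le h_sup]] :=
  label_family polishX d_pseudometric Phi_pseudometric Phi_cont d_sup.
have [z z_dense] := coding_dist_dense D_compat h_cont Gs Xs x0.
have [iota iotaE] :=
  urysohn_embedding urysohnU (coding_dist_pseudometric D_compat h_itv) z_dense.
have [d_ge0 d_xx d_sym d_tri] := d_pseudometric.
have [act1 actM actC] := act_cont.
have [v v_dense] := dense_sequence Us (iota (1%g, 0%N, x0)).
exists (orbit_closed act iota).
  apply: (wijsman_borel v_dense) => u r.
  exact: (wijsman_orbit_open D_compat h_cont act_cont iotaE).
move=> eps eps0.
have [q [q0 q1 q_eps h_q]] : exists q : R, [/\ 0 < q, q <= 1, q < eps
    & forall z w, (forall m, `|h m z - h m w| <= q) -> (d z w <= q%:E)%E].
  have [n _ /(_ n (leqnn n))/= n_eps] := near_infty_natSinv_lt (PosNum eps0).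
  exists n.+2%:R^-1; split => //; first by rewrite invf_le1// ler1n.
    by apply: le_lt_trans n_eps; rewrite lef_pV2 ?posrE// ler_nat.
  exact: h_sup.
(* With [c = q / 16], [gh_orbit_lt] applies because [16 * c = q <= 1], and it bounds the label
   differences by [4 * c <= q]. *)
exists eps, (q / 16); split => //; first by rewrite divr_gt0.
- move=> x y /ereal_inf_lt[_ [g _ <-] gxy].
  have gE : d (act g x) y \is a fin_num.
    by rewrite ge0_fin_numE//; apply: lt_trans gxy (ltry _).
  apply: le_lt_trans gxy; rewrite -(fineK gE).
  apply: (gh_orbit_le D_compat iotaE (g := g)) => // k t.
  have label_le w w' : (`|layer_label h k w - layer_label h k w'|%:E <= d w w')%E.
    by case: k => [|[|k]] /=; rewrite ?subrr ?normr0.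
  (* By invariance under [g * t], [d] between [t^-1 x] and [(g t)^-1 y] equals [d (act g x) y]. *)
  rewrite -lee_fin (fineK gE); apply: le_trans (label_le _ _) _.
  by rewrite (d_invariant (g * t)%g) -!actM mulgV act1 mulgK.
- move=> x y /(gh_orbit_lt D_compat h_itv h_cont act_cont iotaE Gc).
  case; [by rewrite divr_gt0|by lra|move=> g [t gt]].
  apply: (@le_lt_trans _ _ q%:E); last by rewrite lte_fin.
  (* Applying [t] to both decoded points [g^-1 x] and [t^-1 y] exhibits [t * g^-1] as the group
     element for the orbit pseudometric. *)
  apply: (@le_trans _ _ (d (act (t * g^-1)%g x) y)).
    by apply: ereal_inf_lbound; exists (t * g^-1)%g.
  have -> : d (act (t * g^-1)%g x) y = d (act g^-1%g x) (act t^-1%g y).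
    by rewrite [RHS](d_invariant t) -!actM mulgV act1.
  by apply: h_q => m; apply: le_trans (gt m) _; lra.
Qed.
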